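(* Let $n\ge 1$ and let $M_n$ be the monoid given by the monoid presentation with generators $e_i$ ($1\le i\le n$) and $a_i$ ($1\le i\le n-1$), and defining relations (for all indices for which the generators involved exist): \begin{align*} e_i^2&=e_i, &&\\ e_ie_j&=e_je_i, &&\\ e_ia_j&=a_je_i && (i<j \text{ or } i>j+1),\\ a_ia_j&=a_ja_i && (|i-j|\ge 2),\\ e_ia_i&=a_ie_{i+1}=a_i && (i\le n-1),\\ e_{i+1}a_i&=a_ie_i=e_ie_{i+1} && (i\le n-1). \end{align*} Then $M_n$ is isomorphic to $IC_n$.
   Context: $[n]=\{1,\dots,n\}$ with its natural linear order. Partial maps act on the right and are composed from left to right: $x(\alpha\beta)=(x\alpha)\beta$ whenever defined. A partial map $\alpha$ of $[n]$ is order-decreasing if $x\alpha\le x$ for all $x\in\mathrm{dom}(\alpha)$, and order-preserving if $x\alpha\le y\alpha$ for all $x\le y$ in $\mathrm{dom}(\alpha)$. $IC_n$ is the monoid (under composition) of all partial one-to-one order-preserving and order-decreasing maps of $[n]$ (including the empty map). For a set $A$ and $R\subseteq A^*\times A^*$, the monoid presentation $\langle A:R\rangle$ denotes the quotient of the free monoid $A^*$ by the congruence generated by $R$. *)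

(* Defs.v *)
From HB Require Import structures.
From mathcomp Require Import all_boot.
From mathcomp Require Import boolp.

Set Implicit Arguments.
Unset Strict Implicit.
Unset Printing Implicit Defensive.

Local Open Scope quotient_scope.

Section Presentation.
Variable A : choiceType.
Implicit Types (R : seq A -> seq A -> Prop) (u v w : seq A).

(* The free monoid A^* is [seq A] under concatenation. *)
Inductive generated_congruence R : seq A -> seq A -> Prop :=
| gcong_rel u v : R u v -> generated_congruence R u v
| gcong_refl u : generated_congruence R u u
| gcong_sym u v : generated_congruence R u v -> generated_congruence R v u
| gcong_trans u v w : generated_congruence R u v ->
    generated_congruence R v w -> generated_congruence R u w
| gcong_cat u u' v v' : generated_congruence R u u' ->
    generated_congruence R v v' -> generated_congruence R (u ++ v) (u' ++ v').

Definition gcongb R : rel (seq A) := fun u v => `[< generated_congruence R u v >].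

Fact gcongb_refl R : reflexive (gcongb R).
Proof. by move=> u; apply/asboolP; exact: gcong_refl. Qed.

Fact gcongb_sym R : symmetric (gcongb R).
Proof. by move=> u v; apply/asboolP/asboolP; exact: gcong_sym. Qed.

Fact gcongb_trans R : transitive (gcongb R).
Proof.
move=> v u w /asboolP uv /asboolP vw; apply/asboolP; exact: gcong_trans uv vw.
Qed.

Canonical gcong_equiv R :=
  EquivRel (gcongb R) (@gcongb_refl R) (@gcongb_sym R) (@gcongb_trans R).

(* The monoid < A : R >. *)
Definition presented_monoid R := {eq_quot gcong_equiv R}.

HB.instance Definition _ R := Choice.on (presented_monoid R).

Lemma pi_presentedP R u v :
  (u = v %[mod presented_monoid R]) <-> generated_congruence R u v.
Proof. by split=> [/eqmodP/asboolP|uv]; last exact/eqmodP/asboolP. Qed.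

Definition presented_one R : presented_monoid R := \pi_(presented_monoid R) [::].
Definition presented_mul R (x y : presented_monoid R) : presented_monoid R :=
  \pi_(presented_monoid R) (repr x ++ repr y).

Lemma presented_mul_pi R u v :
  presented_mul (\pi_(presented_monoid R) u) (\pi_(presented_monoid R) v)
  = \pi_(presented_monoid R) (u ++ v).
Proof. by apply/pi_presentedP/gcong_cat; apply/pi_presentedP; rewrite reprK. Qed.

Fact presented_mulA R : associative (@presented_mul R).
Proof.
elim/quotW=> u; elim/quotW=> v; elim/quotW=> w.
by rewrite (presented_mul_pi _ v w) (presented_mul_pi _ u v) !presented_mul_pi catA.
Qed.

Fact presented_mul1g R : left_id (presented_one R) (@presented_mul R).
Proof. by move=> x; rewrite -[x]reprK; exact: presented_mul_pi. Qed.

Fact presented_mulg1 R : right_id (presented_one R) (@presented_mul R).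
Proof.
by move=> x; rewrite -[x in LHS]reprK [LHS]presented_mul_pi cats0 reprK.
Qed.

HB.instance Definition _ R := isMonoid.Build (presented_monoid R)
  (@presented_mulA R) (@presented_mul1g R) (@presented_mulg1 R).

End Presentation.

(* Partial maps of [n]. The set {1, ..., n} is represented by 'I_n, with all
   indices shifted down by one; [f x = None] means that x is not in dom(f). *)
Definition pmap_of (n : nat) := {ffun 'I_n -> option 'I_n}.

HB.instance Definition _ n := Finite.on (pmap_of n).

Section PartialMaps.
Variable n : nat.
Implicit Types f g : pmap_of n.

Definition pm_one : pmap_of n := [ffun x => Some x].

(* Maps act on the right: x (f g) = (x f) g. *)
Definition pm_mul f g : pmap_of n := [ffun x => obind g (f x)].

Fact pm_mulA : associative pm_mul.
Proof.
by move=> f g h; apply/ffunP => x; rewrite !ffunE; case: (f x) => //= y; rewrite ffunE.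
Qed.

Fact pm_mul1g : left_id pm_one pm_mul.
Proof. by move=> f; apply/ffunP => x; rewrite !ffunE. Qed.

Fact pm_mulg1 : right_id pm_one pm_mul.
Proof. by move=> f; apply/ffunP => x; rewrite ffunE; case: (f x) => //= y; rewrite ffunE. Qed.

HB.instance Definition _ := isMonoid.Build (pmap_of n) pm_mulA pm_mul1g pm_mulg1.

Definition pm_dom f : {pred 'I_n} := [pred x | isSome (f x)].

Definition pm_injective f : bool := dinjectiveb f (pm_dom f).

Definition order_decreasing f : bool :=
  [forall x : 'I_n, forall y : 'I_n, (f x == Some y) ==> (y <= x)].

Definition order_preserving f : bool :=
  [forall x1 : 'I_n, forall x2 : 'I_n, forall y1 : 'I_n, forall y2 : 'I_n,
    [&& f x1 == Some y1, f x2 == Some y2 & x1 <= x2] ==> (y1 <= y2)].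

Definition in_IC : pred (pmap_of n) :=
  fun f => [&& pm_injective f, order_preserving f & order_decreasing f].

Lemma pm_injectiveP f :
  reflect (forall x1 x2 y, f x1 = Some y -> f x2 = Some y -> x1 = x2)
          (pm_injective f).
Proof.
apply: (iffP (dinjectiveP _ _)) => inj_f.
  by move=> x1 x2 y e1 e2; apply: inj_f; rewrite ?inE /= ?e1 ?e2.
move=> x1 x2; rewrite !inE; case e1: (f x1) => [y|] // _ _ /esym e2.
exact: inj_f e1 e2.
Qed.

Lemma order_decreasingP f :
  reflect (forall x y, f x = Some y -> y <= x) (order_decreasing f).
Proof.
apply: (iffP 'forall_'forall_implyP) => H x y; first by move/eqP; exact: H.
by move/eqP; exact: H.
Qed.

Lemma order_preservingP f :
  reflect (forall x1 x2 y1 y2, f x1 = Some y1 -> f x2 = Some y2 ->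
             x1 <= x2 -> y1 <= y2) (order_preserving f).
Proof.
apply: (iffP 'forall_'forall_'forall_'forall_implyP) => H x1 x2 y1 y2.
  by move=> /eqP e1 /eqP e2 le12; apply: (H x1 x2); rewrite e1 e2.
by case/and3P=> /eqP e1 /eqP e2; exact: H e1 e2.
Qed.

Fact in_IC_monoid_closed : monoid_closed in_IC.
Proof.
split=> [|f g].
  apply/and3P; split.
  - by apply/pm_injectiveP => x1 x2 y; rewrite !ffunE => -[->] [->].
  - by apply/order_preservingP => x1 x2 y1 y2; rewrite !ffunE => -[->] [->].
  - by apply/order_decreasingP => x y; rewrite ffunE => -[->].
case/and3P=> /pm_injectiveP fi /order_preservingP fp /order_decreasingP fd.
case/and3P=> /pm_injectiveP gi /order_preservingP gp /order_decreasingP gd.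
apply/and3P; split.
- apply/pm_injectiveP => x1 x2 y; rewrite !ffunE.
  case e1: (f x1) => [z1|] //= h1; case e2: (f x2) => [z2|] //= h2.
  by apply: (fi _ _ z1) => //; rewrite e2 (gi _ _ _ h1 h2).
- apply/order_preservingP => x1 x2 y1 y2; rewrite !ffunE.
  case e1: (f x1) => [z1|] //= h1; case e2: (f x2) => [z2|] //= h2 le12.
  exact: gp h1 h2 (fp _ _ _ _ e1 e2 le12).
- apply/order_decreasingP => x y; rewrite ffunE.
  case e: (f x) => [z|] //= h; exact: leq_trans (gd _ _ h) (fd _ _ e).
Qed.

End PartialMaps.

Record IC (n : nat) := MkIC { IC_val :> pmap_of n; IC_valP : in_IC IC_val }.

HB.instance Definition _ n := [isSub for @IC_val n].
HB.instance Definition _ n := [Finite of IC n by <:].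
HB.instance Definition _ n :=
  SubChoice_isSubMonoid.Build (pmap_of n) (@in_IC n) (IC n) (@in_IC_monoid_closed n).

Lemma IC_mulE n (f g : IC n) x : val (f * g)%g x = obind (val g) (val f x).
Proof. exact: ffunE. Qed.

Lemma IC_oneE n x : val (1%g : IC n) x = Some x.
Proof. exact: ffunE. Qed.

(* Generators: [inl i] is e_(i+1) for i : 'I_n, [inr i] is a_(i+1) for
   i : 'I_n.-1. *)
Definition IC_gen (n : nat) : choiceType := ('I_n + 'I_n.-1)%type.

Section Relations.
Variable n : nat.

Definition gen_e (i : 'I_n) : IC_gen n := inl i.
Definition gen_a (i : 'I_n.-1) : IC_gen n := inr i.

(* For i standing for the index i+1 of a generator a_(i+1), [idx i] and
   [idxS i] are the indices of e_(i+1) and e_(i+2). *)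
Definition idx (i : 'I_n.-1) : 'I_n := widen_ord (leq_pred n) i.

Fact idxS_subproof (i : 'I_n.-1) : i.+1 < n.
Proof. by rewrite -ltn_predRL. Qed.

Definition idxS (i : 'I_n.-1) : 'I_n := Ordinal (idxS_subproof i).

(* A chain of equations u = v = w is entered as the pairs (u, w) and (v, w). *)
Inductive IC_rel : seq (IC_gen n) -> seq (IC_gen n) -> Prop :=
| rel_ee (i : 'I_n) : IC_rel [:: gen_e i; gen_e i] [:: gen_e i]
| rel_eeC (i j : 'I_n) : IC_rel [:: gen_e i; gen_e j] [:: gen_e j; gen_e i]
| rel_eaC (i : 'I_n) (j : 'I_n.-1) : i < j \/ i > j + 1 ->
    IC_rel [:: gen_e i; gen_a j] [:: gen_a j; gen_e i]
| rel_aaC (i j : 'I_n.-1) : i + 2 <= j \/ j + 2 <= i ->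
    IC_rel [:: gen_a i; gen_a j] [:: gen_a j; gen_a i]
| rel_ea (i : 'I_n.-1) : IC_rel [:: gen_e (idx i); gen_a i] [:: gen_a i]
| rel_ae (i : 'I_n.-1) : IC_rel [:: gen_a i; gen_e (idxS i)] [:: gen_a i]
| rel_eSa (i : 'I_n.-1) :
    IC_rel [:: gen_e (idxS i); gen_a i] [:: gen_e (idx i); gen_e (idxS i)]
| rel_aei (i : 'I_n.-1) :
    IC_rel [:: gen_a i; gen_e (idx i)] [:: gen_e (idx i); gen_e (idxS i)].

End Relations.

Definition M (n : nat) := presented_monoid (@IC_rel n).

HB.instance Definition _ n := Monoid.on (M n).

Definition monoid_isomorphic (G H : monoidType) : Prop :=
  exists f : G -> H, monoid_morphism f /\ bijective f.

(* Main.v *)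
Require Import Defs.
From mathcomp Require Import all_boot.
From mathcomp Require Import zify.

(** A map f in IC_n is the value of the word obtained by concatenating, for
    k = 1, ..., n, the block a_(k-1) ... a_(kf) when k is in dom f and e_k when
    it is not. Right multiplication of this word by a generator c can be brought
    back, by the relations, to the word of f c: since f is increasing, c commutes
    with every block that lies after the one it affects, and the idempotents that
    are left over are absorbed by the blocks before it, which do not have
    them in their image. Hence every word equals in M_n the word of its value. *)

Set Implicit Arguments.
Unset Strict Implicit.
Unset Printing Implicit Defensive.

Section NormalForm.
Local Open Scope group_scope.
Variable n : nat.
Implicit Types (f g : nat -> option nat) (i j k m x y : nat).

(** * The defining relations of [M n], with generators indexed by natural numbers *)

Definition M_class (u : seq (IC_gen n)) : M n :=
  \pi_(presented_monoid (@IC_rel n))%qT u.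

Lemma M_class_cat u v : M_class (u ++ v) = M_class u * M_class v.
Proof. by rewrite [RHS]presented_mul_pi. Qed.

Lemma M_class_rel u v : IC_rel u v -> M_class u = M_class v.
Proof. by move=> uv; apply/pi_presentedP/gcong_rel. Qed.

(** Indices are naturals, shifted down by one, and an index out of range gives 1. Idempotency and
    the commutation relations then hold without bounds, and index arithmetic avoids ordinals. *)
Definition M_e k : M n :=
  if insub k is Some i then M_class [:: gen_e i] else 1.

Definition M_a k : M n :=
  if insub k is Some i then M_class [:: gen_a i] else 1.

Lemma M_eE (i : 'I_n) : M_e i = M_class [:: gen_e i].
Proof. by rewrite /M_e valK. Qed.

Lemma M_aE (i : 'I_n.-1) : M_a i = M_class [:: gen_a i].
Proof. by rewrite /M_a valK. Qed.

Lemma M_ee i : M_e i * M_e i = M_e i.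
Proof.
rewrite /M_e; case: insubP => [k _ _|_]; last exact: mulg1.
by rewrite -M_class_cat; apply: M_class_rel; apply: rel_ee.
Qed.

Lemma M_eeC i j : commute (M_e i) (M_e j).
Proof.
rewrite /commute /M_e.
case: insubP => [k _ _|_]; case: insubP => [l _ _|_]; rewrite ?mulg1 ?mul1g //.
by rewrite -!M_class_cat; apply: M_class_rel; apply: rel_eeC.
Qed.

Lemma M_eaC i j : (i < j) || (j.+1 < i) -> commute (M_e i) (M_a j).
Proof.
rewrite /commute /M_e /M_a => ij.
case: insubP => [k _ ek|_]; case: insubP => [l _ el|_]; rewrite ?mulg1 ?mul1g //.
by rewrite -!M_class_cat; apply: M_class_rel; apply: rel_eaC; move: ek el => /=; lia.
Qed.

Lemma M_aaC i j : i.+1 < j -> commute (M_a i) (M_a j).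
Proof.
rewrite /commute /M_a => ij.
case: insubP => [k _ ek|_]; case: insubP => [l _ el|_]; rewrite ?mulg1 ?mul1g //.
by rewrite -!M_class_cat; apply: M_class_rel; apply: rel_aaC; move: ek el => /=; lia.
Qed.

(** Here the default value forces a bound: at i = n-1 the element [M_a i] is 1, and the first
    equation would read e_i = 1. *)
Lemma M_adjacent i : i.+1 < n ->
  [/\ M_e i * M_a i = M_a i, M_a i * M_e i.+1 = M_a i,
      M_e i.+1 * M_a i = M_e i * M_e i.+1 & M_a i * M_e i = M_e i * M_e i.+1].
Proof.
move=> lt_i; have lt_i' : i < n.-1 by lia.
pose k := Ordinal lt_i'.
have -> : M_a i = M_class [:: gen_a k] by rewrite -M_aE.
have -> : M_e i = M_class [:: gen_e (idx k)] by rewrite -M_eE.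
have -> : M_e i.+1 = M_class [:: gen_e (idxS k)] by rewrite -M_eE.
by rewrite -!M_class_cat; split; apply: M_class_rel; constructor.
Qed.

(** * Descending words and their products with idempotents *)

(* The word a_(k-1) a_(k-2) ... a_y, which moves k down to y and kills y, ..., k-1. *)
Definition descent k y : M n := \prod_(i <- rev (index_iota y k)) M_a i.

Lemma descent_ge k y : k <= y -> descent k y = 1.
Proof. by move=> le; rewrite /descent /index_iota (eqP le) big_nil. Qed.

Lemma descent_recr k y : y < k -> descent k y = descent k y.+1 * M_a y.
Proof.
move=> lt; rewrite /descent /index_iota -(subnSK lt) /= rev_cons.
by rewrite big_rcons.
Qed.

Lemma commute_descent (t : M n) k y :
  (forall i, y <= i < k -> commute t (M_a i)) -> commute t (descent k y).
Proof.
move=> H; rewrite /descent big_seq; apply: commute_prod => i.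
by rewrite mem_rev mem_index_iota; apply: H.
Qed.

(** Moving left, e_j commutes with the letters a_i for i < j-1 until it meets a_(j-1), which absorbs
    it by a_i e_(i+1) = a_i. *)
Lemma descent_e k y j : y < j <= k -> k < n ->
  descent k y * M_e j = descent k y.
Proof.
move=> + lt_kn; move def_d: (k - y) => d; elim: d y def_d => [|d IHd] y def_d.
  lia.
move=> ykj; have lt_yk : y < k by lia.
have lt_yn : y.+1 < n by lia.
have [_ aeS _ _] := M_adjacent lt_yn.
rewrite (descent_recr lt_yk) -mulgA; case: (eqVneq j y.+1) => [->|ne_j].
  by rewrite aeS.
have <- : M_e j * M_a y = M_a y * M_e j by apply: M_eaC; lia.
by rewrite mulgA IHd //; lia.
Qed.

(** The last letter gives a_y e_y = e_y e_(y+1). The factor e_y commutes to the front, and e_(y+1)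
    meets the shorter descent in the same way, so every letter turns into an idempotent. *)
Lemma descent_bottom_e k y : y <= k -> k < n ->
  descent k y * M_e y = \prod_(y <= i < k.+1) M_e i.
Proof.
move=> + lt_kn; move def_d: (k - y) => d; elim: d y def_d => [|d IHd] y def_d le.
  have -> : y = k by lia.
  by rewrite descent_ge // mul1g big_nat1.
have lt_yk : y < k by lia.
have lt_yn : y.+1 < n by lia.
have [_ _ _ aei] := M_adjacent lt_yn.
rewrite (descent_recr lt_yk) -mulgA aei big_nat_recl; last lia.
have com : commute (M_e y) (descent k y.+1).
  by apply: commute_descent => i ?; apply: M_eaC; lia.
rewrite mulgA -com -mulgA IHd; [|lia..].
by rewrite big_add1.
Qed.

(** * Normal forms and their right multiplication by the generators *)

Definition block k (o : option nat) : M n :=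
  if o is Some y then descent k y else M_e k.

Definition normal_form g m : M n := \prod_(0 <= k < m) block k (g k).

Lemma normal_formS g m :
  normal_form g m.+1 = normal_form g m * block m (g m).
Proof. exact: big_nat_recr. Qed.

Lemma eq_normal_form f g m :
  (forall k, k < m -> f k = g k) -> normal_form f m = normal_form g m.
Proof. by move=> fg; apply: eq_big_nat => k /fg ->. Qed.


Section Steps.
Variable g : nat -> option nat.
Hypothesis g_decr : forall k y, g k = Some y -> y <= k.
Hypothesis g_incr :
  forall k l x y, k < l -> g k = Some x -> g l = Some y -> x < y.

(** Going left, e_j commutes with a block e_k for k <> j and with a descent ending above j. Block j
    is reached at the latest: it is e_j, or a descent passing through j, since j itself is not a
    value. *)
Lemma normal_form_absorb m j : m <= n -> j < m ->
  (forall k, k < m -> g k <> Some j) ->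
  normal_form g m * M_e j = normal_form g m.
Proof.
elim: m => // m IHm lt_mn lt_jm ne_g; rewrite normal_formS -mulgA.
have IH t : commute t (M_e j) -> j < m ->
    normal_form g m * (t * M_e j) = normal_form g m * t.
  by move=> com lt; rewrite com mulgA IHm //; [lia | move=> k ?; apply: ne_g; lia].
case def_g: (g m) => [y|] /=; have [ejm|ne_jm] := eqVneq j m.
- have ne : j <> y by move=> ejy; apply: (ne_g m) => //; rewrite ejy.
  by rewrite descent_e //; have := g_decr def_g; lia.
- have ne : j <> y by move=> ejy; apply: (ne_g m) => //; rewrite ejy.
  have [lt_jy|le_yj] := ltnP j y; last by rewrite descent_e //; lia.
  apply: IH; last lia.
  by apply/commute_sym/commute_descent => i ?; apply: M_eaC; lia.
- by rewrite ejm M_ee.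
- by apply: IH; [exact: M_eeC | lia].
Qed.

Lemma normal_form_absorb_prod m y l : m <= n -> l <= m ->
  (forall k j, k < m -> y <= j -> g k <> Some j) ->
  normal_form g m * \prod_(y <= i < l) M_e i = normal_form g m.
Proof.
move=> le_mn + ne_g; elim: l => [|l IHl] le_lm; first by rewrite big_geq ?mulg1.
have [le_yl|lt_ly] := leqP y l; last by rewrite big_geq ?mulg1.
rewrite big_nat_recr // mulgA IHl; last lia.
by apply: normal_form_absorb => // k lt_km; apply: ne_g.
Qed.

Definition remove j (o : option nat) : option nat :=
  if o == Some j then None else o.

Lemma normal_form_e m j : m <= n -> j < m ->
  normal_form g m * M_e j = normal_form (remove j \o g) m.
Proof.
move=> le_mn lt_jm.
have [/hasP[x] | /hasPn no_x] := boolP (has (fun x => g x == Some j) (iota 0 m)).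
  rewrite mem_iota add0n /= => lt_xm /eqP def_x {lt_jm}.
  elim: m le_mn lt_xm => // m IHm lt_mn lt_xm; rewrite !normal_formS /= -mulgA.
  have [def_m|ne_m] := eqVneq x m.
    rewrite -{m}def_m in IHm lt_mn lt_xm *; rewrite def_x /= /remove eqxx /=.
    have le_jx := g_decr def_x.
    (* Block x becomes e_j ... e_x. Earlier values are below j, so e_j, ..., e_(x-1) are absorbed by
       the earlier blocks; the remaining e_x is the block of a point outside the domain. *)
    rewrite descent_bottom_e // big_nat_recr // mulgA.
    rewrite normal_form_absorb_prod //; first last.
    - by move=> k i lt_kx le_ji def_k; have := g_incr lt_kx def_k def_x; lia.
    - lia.
    congr (_ * _); apply: eq_normal_form => k lt_kx /=; rewrite /remove.
    by case: eqP => // def_k; have := g_incr lt_kx def_k def_x; lia.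
  (* Block m lies after block x: its value, if any, exceeds j, so e_j commutes with it. *)
  have {ne_m}lt_x : x < m by lia.
  rewrite -IHm //; last lia.
  rewrite -[RHS]mulgA; congr (_ * _); rewrite /remove.
  case def_m: (g m) => [y|] /=; last exact: M_eeC.
  have lt_jy := g_incr lt_x def_x def_m.
  case: eqP => [[]|_] /=; first lia.
  by apply/commute_sym/commute_descent => i ?; apply: M_eaC; lia.
(* When j is not a value, e_j is absorbed and [remove j] changes nothing. *)
rewrite normal_form_absorb // => [|k lt_km]; last first.
  by apply/eqP/no_x; rewrite mem_iota.
apply: eq_normal_form => k lt_km /=; rewrite /remove ifN //.
by apply: no_x; rewrite mem_iota.
Qed.

Definition lower j (o : option nat) : option nat :=
  if o == Some j.+1 then Some j else o.

(** The letter a_j commutes with all blocks after block x, whose values exceed j+1, and then extends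
    the descent of x by one letter. *)
Lemma normal_form_lower m x j : m <= n -> x < m -> g x = Some j.+1 ->
  normal_form g m * M_a j = normal_form (lower j \o g) m.
Proof.
move=> + + def_x; elim: m => // m IHm lt_mn lt_xm.
rewrite !normal_formS /= -mulgA.
have [def_m|ne_m] := eqVneq x m.
  rewrite -{m}def_m in IHm lt_mn lt_xm *; rewrite def_x /= /lower eqxx /=.
  have le_jx := g_decr def_x.
  rewrite -descent_recr //; congr (_ * _); apply: eq_normal_form => k lt_kx /=.
  by case: eqP => // def_k; have := g_incr lt_kx def_k def_x; lia.
have {ne_m}lt_x : x < m by lia.
rewrite -IHm //; last lia.
have le_jx := g_decr def_x.
rewrite -[RHS]mulgA; congr (_ * _); rewrite /lower.
case def_m: (g m) => [y|] /=; last by apply: M_eaC; lia.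
have lt_jy := g_incr lt_x def_x def_m.
case: eqP => [[]|_] /=; first lia.
by apply/commute_sym/commute_descent => i ?; apply: M_aaC; lia.
Qed.

End Steps.

Definition shift j (o : option nat) : option nat :=
  if o == Some j then None else lower j o.

(** Order preservation and injectivity are merged into strict increase on the domain. *)
Definition decreasing_incr g :=
  (forall k y, g k = Some y -> y <= k) /\
  (forall k l x y, k < l -> g k = Some x -> g l = Some y -> x < y).

Lemma remove_decreasing_incr g j :
  decreasing_incr g -> decreasing_incr (remove j \o g).
Proof.
case=> gd gi; split=> [k y|k l x y lt_kl] /=; rewrite /remove.
  by case: eqP => // _; apply: gd.
by case: eqP => // _ def_k; case: eqP => // _; apply: gi lt_kl def_k.
Qed.

Lemma normal_form_a g j : decreasing_incr g -> j.+1 < n ->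
  normal_form g n * M_a j = normal_form (shift j \o g) n.
Proof.
move=> gdi lt_jn; have [ea _ eSa _] := M_adjacent lt_jn.
have hdi := remove_decreasing_incr j gdi.
case: (gdi) (hdi) => gd gi [hd hi].
(* Writing a_j as e_j a_j first removes j from the image, so that only the fate of j+1 remains. *)
rewrite -ea mulgA normal_form_e //; [|lia].
set h := remove j \o g in hdi hd hi *.
have shift_g k : shift j (g k) = lower j (h k).
  by rewrite /shift /h /= /remove; case: eqP.
have [/hasP[x] | /hasPn no_x] := boolP (has (fun x => g x == Some j.+1) (iota 0 n)).
  rewrite mem_iota add0n /= => lt_xn /eqP def_x.
  rewrite (normal_form_lower hd hi _ lt_xn) //.
    by apply: eq_normal_form => k _ /=; rewrite shift_g.
  by rewrite /h /= /remove def_x; case: eqP => // -[]; lia.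
have no_h k : k < n -> h k <> Some j.+1.
  move=> lt_kn; rewrite /h /= /remove; case: eqP => // _.
  by apply/eqP/no_x; rewrite mem_iota.
have no_hj k : h k <> Some j.
  by rewrite /h /= /remove; case: eqP.
(* Neither j nor j+1 is a value of [h]: e_(j+1) can be inserted freely, e_(j+1) a_j = e_j e_(j+1),
   and both idempotents are absorbed. *)
rewrite -(normal_form_absorb hd (leqnn n) lt_jn no_h) -mulgA eSa mulgA.
rewrite (normal_form_absorb hd) //; [|lia].
rewrite (normal_form_absorb hd) //.
by apply: eq_normal_form => k lt_kn /=; rewrite shift_g /lower; case: eqP => // /no_h.
Qed.


(** * The generators as partial maps, and maps extended to all naturals *)

Definition pm_e j : pmap_of n := [ffun x : 'I_n => if x == j :> nat then None else Some x].

(** In the branch x = j+1, the bound on x gives j < n, so [insub j] is defined there. *)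
Definition pm_a j : pmap_of n :=
  [ffun x : 'I_n => if x == j :> nat then None
             else if x == j.+1 :> nat then insub j else Some x].

Lemma pm_eP j (x y : 'I_n) : pm_e j x = Some y -> (x != j :> nat) /\ x = y.
Proof. by rewrite ffunE; case: eqP => // _ []. Qed.

Lemma pm_aP j (x y : 'I_n) : pm_a j x = Some y ->
  (x = j.+1 :> nat) /\ (y = j :> nat) \/ [/\ x != j :> nat, x != j.+1 :> nat & x = y :> nat].
Proof.
rewrite ffunE; case: eqP => // _; case: eqP => [-> | _ [<-]]; last by right.
by case: insubP => // z _ <- [->]; left.
Qed.

Fact in_IC_e j : in_IC (pm_e j).
Proof.
apply/and3P; split.
- by apply/pm_injectiveP => x1 x2 y /pm_eP[_ ->] /pm_eP[_ ->].
- by apply/order_preservingP => x1 x2 y1 y2 /pm_eP[_ ->] /pm_eP[_ ->].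
- by apply/order_decreasingP => x y /pm_eP[_ ->].
Qed.

Fact in_IC_a j : in_IC (pm_a j).
Proof.
apply/and3P; split.
- apply/pm_injectiveP => x1 x2 y h1 h2; apply: val_inj => /=.
  by case: (pm_aP h1) => [[]|[]]; case: (pm_aP h2) => [[]|[]]; lia.
- apply/order_preservingP => x1 x2 y1 y2 h1 h2.
  by case: (pm_aP h1) => [[]|[]]; case: (pm_aP h2) => [[]|[]]; lia.
- by apply/order_decreasingP => x y /pm_aP[[]|[]]; lia.
Qed.

Definition IC_e j : IC n := MkIC (in_IC_e j).
Definition IC_a j : IC n := MkIC (in_IC_a j).

Implicit Type F : IC n.

(* Extending by the identity outside [n] makes the unit [Some]. *)
Definition ext F k : option nat :=
  if insub k is Some x then omap (@nat_of_ord n) (val F x) else Some k.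

Lemma extE F (x : 'I_n) : ext F x = omap (@nat_of_ord n) (val F x).
Proof. by rewrite /ext valK. Qed.

Lemma ext_out F k : n <= k -> ext F k = Some k.
Proof. by move=> le; rewrite /ext insubN // -leqNgt. Qed.

Lemma ext_inj F G : ext F =1 ext G -> F = G.
Proof.
move=> eFG; apply/val_inj/ffunP => x; have := eFG x; rewrite !extE.
by case: (val F x) => [y|]; case: (val G x) => [z|] //= [] /val_inj ->.
Qed.

Lemma ext1 k : ext 1 k = Some k.
Proof. by rewrite /ext; case: insubP => //= x _ <-; rewrite ffunE. Qed.

Lemma extM F G k : ext (F * G) k = obind (ext G) (ext F k).
Proof.
have [lt|le] := ltnP k n; last by rewrite !ext_out //= ext_out.
rewrite -[k]/(val (Ordinal lt)) !extE IC_mulE.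
by case: (val F _) => [y|] //=; rewrite extE.
Qed.

Lemma ext_e j k : j < n -> ext (IC_e j) k = remove j (Some k).
Proof.
move=> lt_jn; rewrite /remove (inj_eq Some_inj).
have [lt|le] := ltnP k n; last by rewrite ext_out //; case: eqP => //; lia.
by rewrite -[k]/(val (Ordinal lt)) extE ffunE; case: eqP.
Qed.

Lemma ext_a j k : j.+1 < n -> ext (IC_a j) k = shift j (Some k).
Proof.
move=> lt_jn; rewrite /shift /lower !(inj_eq Some_inj).
have [lt|le] := ltnP k n; last by rewrite ext_out //; do 2 (case: eqP => [?|_]; first lia).
rewrite -[k]/(val (Ordinal lt)) extE ffunE; case: eqP => // _; case: eqP => // _.
by case: insubP => [x _ /= <-|] //; lia.
Qed.

Lemma ext_mul_e F j k : j < n -> ext (F * IC_e j) k = remove j (ext F k).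
Proof. by move=> lt; rewrite extM; case: (ext F k) => //= y; rewrite ext_e. Qed.

Lemma ext_mul_a F j k : j.+1 < n -> ext (F * IC_a j) k = shift j (ext F k).
Proof. by move=> lt; rewrite extM; case: (ext F k) => //= y; rewrite ext_a. Qed.

Lemma ext_decreasing_incr F : decreasing_incr (ext F).
Proof.
case/and3P: (valP F) => /pm_injectiveP Fi /order_preservingP Fp /order_decreasingP Fd.
have gd k y : ext F k = Some y -> y <= k.
  have [lt|le] := ltnP k n; last by rewrite ext_out // => -[->].
  rewrite -[k]/(val (Ordinal lt)) extE.
  by case def_z: (val F _) => [z|] //= [<-]; apply: Fd def_z.
split=> // k l x y lt_kl def_x def_y.
(* From n on the extension is the identity, so y = l > k >= x. *)
have [le|lt_ln] := leqP n l.
  by move: def_y; rewrite ext_out // => -[<-]; have := gd _ _ def_x; lia.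
have lt_kn : k < n by lia.
move: def_x def_y; rewrite -[k]/(val (Ordinal lt_kn)) -[l]/(val (Ordinal lt_ln)) !extE.
case def_x: (val F _) => [x'|] //= [<-]; case def_y: (val F _) => [y'|] //= [<-].
rewrite ltn_neqAle (Fp _ _ _ _ def_x def_y) ?andbT /=; last exact: ltnW.
apply/eqP => /val_inj exy; rewrite exy in def_x.
by have [] := Fi _ _ _ def_x def_y; lia.
Qed.

(** * Evaluation of words and the homomorphism from [M n] to [IC n] *)

Definition gen_val (c : IC_gen n) : IC n :=
  match c with inl i => IC_e i | inr i => IC_a i end.

Definition word_val (u : seq (IC_gen n)) : IC n := \prod_(c <- u) gen_val c.

(** Applied to a point k, each relation becomes an identity between composites of [remove] and
    [shift], settled by comparing indices. *)
Lemma word_val_rel u v : IC_rel u v -> word_val u = word_val v.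
Proof.
move=> uv; apply: ext_inj => k.
have lt_i (i : 'I_n.-1) : i < n /\ i.+1 < n by have := ltn_ord i; lia.
case: uv => [i|i j|i j|i j|i|i|i|i]; rewrite /word_val !big_cons big_nil !mulg1 /=;
  rewrite ?(ext_mul_e, ext_mul_a, ext_e, ext_a) //=;
  try (by case: (lt_i i)); try (by case: (lt_i j)).
all: rewrite /shift /lower /remove => *;
  repeat (rewrite ?(inj_eq Some_inj) /=; case: (@eqP nat _ _) => //= ?);
  solve [lia | congr Some; lia].
Qed.

Lemma word_val_cat u v : word_val (u ++ v) = word_val u * word_val v.
Proof. exact: big_cat. Qed.

Lemma word_val_congruence u v :
  generated_congruence (@IC_rel n) u v -> word_val u = word_val v.
Proof.
elim=> {u v} [u v /word_val_rel|u|u v _ ->|u v w _ -> _ ->|u u' v v' _ e _ e'] //.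
by rewrite !word_val_cat e e'.
Qed.

(** The chosen representative is immaterial by [eval_class]. *)
Definition eval (t : M n) : IC n := word_val (repr t).

Lemma eval_class u : eval (M_class u) = word_val u.
Proof. by apply/word_val_congruence/pi_presentedP; rewrite reprK. Qed.

Lemma M_classP (t : M n) : exists u, t = M_class u.
Proof. by exists (repr t); rewrite /M_class reprK. Qed.

Lemma eval1 : eval 1 = 1.
Proof. by rewrite [LHS](eval_class [::]) /word_val big_nil. Qed.

Lemma evalM t t' : eval (t * t') = eval t * eval t'.
Proof.
have [[u ->] [v ->]] := (M_classP t, M_classP t').
by rewrite -M_class_cat !eval_class word_val_cat.
Qed.

Lemma eval_e j : j < n -> eval (M_e j) = IC_e j.
Proof.
move=> lt; rewrite -[j]/(val (Ordinal lt)) M_eE eval_class.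
by rewrite /word_val big_seq1.
Qed.

Lemma eval_a j : j.+1 < n -> eval (M_a j) = IC_a j.
Proof.
move=> lt; have lt' : j < n.-1 by lia.
by rewrite -[j]/(val (Ordinal lt')) M_aE eval_class /word_val big_seq1.
Qed.

(** * Values of normal forms *)

Lemma ext_eval_descent k y x : y <= k -> k < n ->
  ext (eval (descent k y)) x =
    if x == k then Some y else if y <= x < k then None else Some x.
Proof.
move=> + lt_kn; move def_d: (k - y) => d; elim: d y def_d => [|d IHd] y def_d le_yk.
  have -> : y = k by lia.
  rewrite descent_ge // eval1 ext1; case: eqP => [->|_] //.
  by case: ifP => //; lia.
rewrite descent_recr ?evalM ?eval_a ?ext_mul_a ?IHd; try lia.
rewrite /shift /lower; case: (eqVneq x k) => [_|ne].
  by rewrite !(inj_eq Some_inj) eqxx; case: eqP => //; lia.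
case: (boolP (y < x < k)) => [lt_yx|nlt_yx] /=.
  by rewrite ifT //; lia.
by rewrite !(inj_eq Some_inj); do 3?[case: ifP => //= ?]; lia.
Qed.

(** Block m sends m to its final place and fixes the values already reached: these are below m, and
    below [g m] when it is defined, while a descent from m to y moves or kills only y, ..., m. *)
Lemma ext_eval_normal_form g m x : decreasing_incr g -> m <= n ->
  ext (eval (normal_form g m)) x = if x < m then g x else Some x.
Proof.
case=> gd gi; elim: m => [|m IHm] lt_mn.
  by rewrite /normal_form big_geq // eval1 ext1.
rewrite normal_formS evalM extM IHm; last exact: ltnW.
have [lt_xm|le_mx] := ltnP x m.
  rewrite ltnS ltnW //; case def_x: (g x) => [z|] //=.
  have le_zx := gd _ _ def_x.
  case def_m: (g m) => [y|] /=; last first.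
    by rewrite eval_e // ext_e // /remove (inj_eq Some_inj); case: eqP => //; lia.
  have lt_zy := gi _ _ _ _ lt_xm def_x def_m; have le_ym := gd _ _ def_m.
  rewrite ext_eval_descent //; case: eqP => [|_]; first lia.
  by case: ifP => //; lia.
rewrite ltnS /=; have [lt_mx|le_xm] := ltnP m x.
  case def_m: (g m) => [y|] /=.
    have le_ym := gd _ _ def_m; rewrite ext_eval_descent //.
    by case: eqP => [|_]; [lia|case: ifP => //; lia].
  by rewrite eval_e // ext_e // /remove (inj_eq Some_inj); case: eqP => //; lia.
have -> : x = m by lia.
case def_m: (g m) => [y|] /=.
  by rewrite ext_eval_descent ?eqxx //; apply: gd def_m.
by rewrite eval_e // ext_e // /remove eqxx.
Qed.

(** * Evaluation and normal form are mutually inverse *)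

Definition normal_form_of F : M n := normal_form (ext F) n.

Lemma normal_form_ofK : cancel normal_form_of eval.
Proof.
move=> F; apply: ext_inj => x.
rewrite ext_eval_normal_form //; last exact: ext_decreasing_incr.
by case: ltnP => // le; rewrite ext_out.
Qed.

(** Induction on the last letter: the rules for right multiplication by e_j and a_j match the effect
    of these generators on values. *)
Lemma normal_form_of_word u : normal_form_of (word_val u) = M_class u.
Proof.
elim/last_ind: u => [|u c IHu].
  rewrite /word_val big_nil /normal_form_of /normal_form.
  (* For the identity map every block is [descent k k], an empty product. *)
  rewrite big1_seq // => k _; rewrite ext1 /= descent_ge //.
rewrite -cats1 M_class_cat word_val_cat -IHu {2}/word_val big_seq1.
have gdi := ext_decreasing_incr (word_val u).
case: c => [i|i] /=.
  rewrite -M_eE normal_form_e ?ltn_ord //; [|by case: gdi..].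
  by apply: eq_normal_form => k _; rewrite ext_mul_e.
have lt_i : i.+1 < n by have := ltn_ord i; lia.
rewrite -M_aE normal_form_a //.
by apply: eq_normal_form => k _; rewrite ext_mul_a.
Qed.

Lemma evalK : cancel eval normal_form_of.
Proof.
by move=> t; have [u ->] := M_classP t; rewrite eval_class normal_form_of_word.
Qed.

End NormalForm.

Theorem mainTheorem3 (n : nat) (hn : 1 <= n) : monoid_isomorphic (M n) (IC n).
Proof.
exists (@eval n); split; first by split; [exact: eval1 | exact: evalM].
exact: Bijective (@evalK n) (@normal_form_ofK n).
Qed.
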